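(* Let $N\ge 2$ be an integer, $s\ge 0$, $t\ge 1$, and $0<\alpha<\pi^{-1}$. Then $\omega_N$ is a minimal $N$-point $s,\log^t$-energy configuration on $\mathbb{S}^1_\alpha$ with the geodesic distance $L$ if and only if $\omega_N$ is a configuration of $N$ distinct equally spaced points on $\mathbb{S}^1_\alpha$.
   Context: $\mathbb{S}^1_\alpha:=\{x\in\mathbb{R}^2: |x|=\alpha\}$ is the circle of radius $\alpha$ centered at $0$ ($|\cdot|$ the Euclidean norm), and $L(x,y)$ is the geodesic distance on it, i.e. the length of the shorter arc of $\mathbb{S}^1_\alpha$ connecting $x$ and $y$. For a metric space $(A,d)$ and a set $\omega_N\subset A$ of $N$ distinct points, $$E^s_{\log^t}(\omega_N):=\sum_{\substack{x\ne y\\ x,y\in\omega_N}}\frac{1}{d(x,y)^s}\left(\log\frac{1}{d(x,y)}\right)^t$$ (sum over ordered pairs of distinct points). A minimal $N$-point $s,\log^t$-energy configuration on $A$ with the metric $d$ is a set $\omega_N\subset A$ of $N$ distinct points minimizing $E^s_{\log^t}$ among all sets of $N$ distinct points of $A$; here $A=\mathbb{S}^1_\alpha$, $d=L$. Points are equally spaced on the circle if consecutive ones are separated by arcs of equal length $2\pi\alpha/N$. *)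

(* Defs.v *)
From HB Require Import structures.
From mathcomp Require Import all_boot all_order all_algebra finmap.
From mathcomp Require Import all_classical all_reals all_analysis.

Set Implicit Arguments.
Unset Strict Implicit.
Unset Printing Implicit Defensive.

Import Order.TTheory GRing.Theory Num.Theory.

Local Open Scope classical_set_scope.
Local Open Scope fset_scope.
Local Open Scope ring_scope.

Section Energy.
Context {R : realType} {T : choiceType}.
Implicit Types (A : set T) (d : T -> T -> R) (w : {fset T}).

(* A metric space is given as a subset A of a type T together with a distance
   d on T; only the values of d on A matter. *)
Definition is_config A (N : nat) w : Prop :=
  (forall x, x \in w -> A x) /\ #|` w| = N.

Definition log_energy d (s t : R) w : R :=
  \sum_(x <- w) \sum_(y <- w | x != y)
    1 / (d x y `^ s) * (ln (1 / d x y) `^ t).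

Definition is_minimal_config A d (s t : R) (N : nat) w : Prop :=
  is_config A N w /\
  forall w', is_config A N w' -> log_energy d s t w <= log_energy d s t w'.

End Energy.

Section Circle.
Context {R : realType}.
Implicit Types (x y : R * R) (alpha theta : R).

(* The library norm on R * R is the max norm, not the Euclidean one. *)
Definition enorm x : R := Num.sqrt (x.1 ^+ 2 + x.2 ^+ 2).

Definition circle alpha : set (R * R) := [set x | enorm x = alpha].

Definition circle_pt alpha theta : R * R :=
  (alpha * cos theta, alpha * sin theta).

(* Lengths (radius times central angle) of the arcs with endpoints x and y.
   For distinct x and y on the circle there are exactly two of them, with sum
   2 * pi * alpha. *)
Definition arc_lengths alpha x y : set R :=
  [set l | exists a b : R,
     [/\ circle_pt alpha a = x, circle_pt alpha b = y,
         `|a - b| <= 2 * pi & l = alpha * `|a - b| ] ].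

Definition geodesic_dist alpha x y : R := inf (arc_lengths alpha x y).

(* a 0, ..., a N are the angles of the successive points met in one
   counterclockwise turn, so that a N is again the first point. *)
Definition equally_spaced alpha (N : nat) (w : {fset R * R}) : Prop :=
  exists a : nat -> R,
    [/\ forall x, x \in w <-> exists2 k, (k < N)%N & x = circle_pt alpha (a k),
        a N = a 0%N + 2 * pi
      & forall k, (k < N)%N ->
          alpha * (a k.+1 - a k) = 2 * pi * alpha / N%:R ].

End Circle.

(* Main.v *)
Require Import Defs.
From HB Require Import structures.
From mathcomp Require Import all_boot all_order all_algebra finmap.
From mathcomp Require Import all_classical all_reals all_analysis.
From mathcomp Require Import lra ring zify.

Set Implicit Arguments.
Unset Strict Implicit.
Unset Printing Implicit Defensive.

Import Order.TTheory GRing.Theory Num.Theory.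

Local Open Scope classical_set_scope.
Local Open Scope fset_scope.
Local Open Scope ring_scope.

(** Write f r = r^(-s) (log 1/r)^t.  Since s >= 0, t >= 1 and the longest geodesic
has length pi * alpha < 1, f is only evaluated on the interval (0, 1), where
  -f'(r) = r^(-s-1) (s L^t + t L^(t-1)),   L = log 1/r > 0,
is positive and strictly decreasing: f is strictly decreasing and strictly
convex there ([potential_tangent]).

Describe a configuration by the increasing angles th_0 < ... < th_n of its
N = n + 1 points within one turn, and let the gap from i to j be the angle d_ij
in (0, 2 pi) travelled counterclockwise from point i to point j.  The distance
of the two points is alpha * min (d_ij, 2 pi - d_ij), so that the energy is the
sum of G (d_ij) over i <> j, with G d = f (alpha * min (d, 2 pi - d)).  This G is
strictly convex on all of (0, 2 pi): on each half because f is, and across the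
kink at pi because f decreases ([arc_potential_tangent]).

In the regular N-gon the gap from i to j is c_(j-i) = 2 pi (j - i mod N) / N.  In
general d_ij = c_(j-i) + (u_j - u_i), where u_i = th_i - 2 pi i / N is the
deviation of the i-th angle ([arc_gapE]).  The tangent line of G at c_(j-i)
gives
  G (d_ij) >= G (c_(j-i)) + mu (c_(j-i)) (u_j - u_i),
with equality only if u_j = u_i.  Summed over i <> j, the linear terms vanish:
for each fixed difference k = j - i in Z/N, the sums of the u_(i+k) and of the
u_i over i coincide ([sum_shift_diff_eq0]).  Hence the energy is at least that of the
regular N-gon, with equality exactly when u is constant, i.e. when the points
are equally spaced ([regular_energy_leif]). *)

(** * Strict convexity of the potential *)

Section Potential.
Variables (R : realType) (s t : R).
Hypotheses (hs : 0 <= s) (ht : 1 <= t).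

Let t0 : 0 < t. Proof. exact: lt_le_trans ht. Qed.

Definition potential (r : R) : R := 1 / (r `^ s) * (ln (1 / r) `^ t).

(** The derivative of the potential on the interval (0, 1). *)
Definition potential_slope (r : R) : R :=
  - (r^-1 * expR (s * - ln r) * (s * (- ln r) `^ t + t * (- ln r) `^ (t - 1))).

(* The exponential form, valid for r > 0, is easier to differentiate. *)
Let pot_exp (r : R) : R := expR (s * - ln r) * (- ln r) `^ t.

Lemma potentialE r : 0 < r -> potential r = pot_exp r.
Proof.
move=> r0; rewrite /potential /pot_exp !div1r lnV ?posrE//; congr (_ * _).
by rewrite /powR gt_eqF// mulrN expRN.
Qed.

Lemma Nln_gt0 (r : R) : 0 < r < 1 -> 0 < - ln r.
Proof. by move=> r01; rewrite oppr_gt0 ln_lt0. Qed.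

Lemma is_derive_pot_exp (r : R) : 0 < r < 1 ->
  is_derive r (1 : R) pot_exp (potential_slope r).
Proof.
move=> /[dup] /Nln_gt0 L0 /andP[r0 r1].
have dln : is_derive r (1 : R) (fun x : R => - ln x) (- r^-1).
  by apply: is_deriveN; exact: is_derive1_ln.
have dexp : is_derive r (1 : R) (expR \o (fun x : R => s * - ln x))
    (expR (s * - ln r) * (s * - r^-1)).
  by apply: is_derive1_comp; exact: (is_deriveZ s dln).
have dpow : is_derive r (1 : R) ((@powR R ^~ t) \o (fun x : R => - ln x))
    (t * (- ln r) `^ (t - 1) * (- r^-1)).
  by apply: is_derive1_comp; exact: is_derive1_powR.
have := is_deriveM dexp dpow.
rewrite (_ : _ *: _ + _ = potential_slope r)//.
by rewrite /potential_slope /GRing.scale /=; ring.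
Qed.

Lemma potential_slope_lt0 (r : R) : 0 < r < 1 -> potential_slope r < 0.
Proof.
move=> /[dup] /Nln_gt0 L0 /andP[r0 r1].
rewrite oppr_lt0 !mulr_gt0 ?invr_gt0 ?expR_gt0//.
by rewrite ltr_wpDl ?mulr_ge0 ?powR_ge0// mulr_gt0 ?powR_gt0.
Qed.

(** The three factors of the opposite of the slope are nonincreasing in the
distance, the first one strictly; the last one needs [1 <= t], as it contains
the power [t - 1] of the decreasing function [- ln r]. *)
Lemma potential_slope_incr (x y : R) : 0 < x -> x < y -> y < 1 ->
  potential_slope x < potential_slope y.
Proof.
move=> x0 xy y1.
have y0 : 0 < y by lra.
have Lx : 0 < - ln x by apply: Nln_gt0; lra.
have Ly : 0 < - ln y by apply: Nln_gt0; lra.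
have Lyx : - ln y <= - ln x by rewrite lerN2 ler_ln ?posrE// ltW.
have Pmono p : 0 <= p -> (- ln y) `^ p <= (- ln x) `^ p.
  by move=> p0; apply: ge0_ler_powR; rewrite ?nnegrE// ltW.
rewrite ltrN2.
have P0 : 0 < s * (- ln y) `^ t + t * (- ln y) `^ (t - 1).
  by rewrite ltr_wpDl ?mulr_ge0 ?powR_ge0// mulr_gt0 ?powR_gt0.
apply: (@lt_le_trans _ _ (x^-1 * expR (s * - ln y) *
   (s * (- ln y) `^ t + t * (- ln y) `^ (t - 1)))).
  by rewrite ltr_pM2r// ltr_pM2r ?expR_gt0// ltf_pV2.
apply: ler_pM; rewrite ?mulr_ge0 ?invr_ge0 ?expR_ge0 ?(ltW x0) ?(ltW P0)//.
  by rewrite ler_pM2l ?invr_gt0// ler_expR ler_wpM2l.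
apply: lerD; apply: ler_wpM2l => //; try apply: Pmono => //.
- exact: ltW.
- exact: ltW.
- by rewrite subr_ge0.
Qed.

(** Strict convexity in the form in which it is summed later on; it follows from
the mean value theorem, the derivative being increasing. *)
Lemma potential_tangent (c x : R) : 0 < c < 1 -> 0 < x < 1 -> x != c ->
  potential c + potential_slope c * (x - c) < potential x.
Proof.
move=> /andP[c0 c1] /andP[x0 x1] xc.
have mvt (a b : R) : 0 < a -> a < b -> b < 1 ->
    exists2 z, a < z < b & potential b - potential a = potential_slope z * (b - a).
  move=> a0 ab b1.
  have [||z zab E] := @MVT R pot_exp potential_slope a b ab.
  - by move=> z; rewrite in_itv/= => zab; apply: is_derive_pot_exp; lra.
  - apply: derivable_within_continuous => z; rewrite in_itv/= => zab.
    by apply: ex_derive; apply: is_derive_pot_exp; lra.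
  by exists z => //; rewrite !potentialE// (lt_trans a0).
have [xltc|cltx] : x < c \/ c < x by apply/orP; rewrite -neq_lt.
- have [z /andP[xz zc] E] := mvt _ _ x0 xltc c1.
  have : potential_slope z < potential_slope c by apply: potential_slope_incr => //; lra.
  by move: E; nra.
- have [z /andP[cz zx] E] := mvt _ _ c0 cltx x1.
  have : potential_slope c < potential_slope z by apply: potential_slope_incr => //; lra.
  by move: E; nra.
Qed.
End Potential.

(** * The potential as a function of the central angle *)

Section Arc.
Variables (R : realType) (s t alpha : R).
Hypotheses (hs : 0 <= s) (ht : 1 <= t) (ha0 : 0 < alpha) (ha1 : alpha < pi^-1).

Definition short_arc (d : R) : R := alpha * Num.min d (2 * pi - d).

Definition arc_potential (d : R) : R := potential s t (short_arc d).

Lemma short_arcC d : short_arc (2 * pi - d) = short_arc d.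
Proof. by rewrite /short_arc (_ : 2 * pi - (2 * pi - d) = d) 1?minC//; ring. Qed.

(** Since [arc_potential] takes the same values at [d] and [2 * pi - d], it
suffices to find tangent lines at [c <= pi].  There the tangent line of the
potential works: for [d <= pi] it is below by convexity, and for [d > pi] it is
lower at [d] than at the reflected angle [2 * pi - d], its slope being negative. *)
Lemma arc_potential_tangent : exists mu : R -> R, forall c d : R,
  0 < c < 2 * pi -> 0 < d < 2 * pi -> d != c ->
  arc_potential c + mu c * (d - c) < arc_potential d.
Proof.
have pi0 := pi_gt0 R.
have apd (d : R) : 0 < d -> d <= pi -> 0 < alpha * d < 1.
  move=> d0 dpi; rewrite mulr_gt0//=.
  have : alpha * pi < 1 by rewrite -(@mulVf _ (pi : R)) ?gt_eqF// ltr_pM2r.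
  by nra.
have near (c d : R) : 0 < c -> c <= pi -> 0 < d < 2 * pi -> d != c ->
    arc_potential c + alpha * potential_slope s t (alpha * c) * (d - c)
      < arc_potential d.
  move=> c0 cpi /andP[d0 d2] dc.
  rewrite /arc_potential /short_arc (min_idPl _ : Num.min c _ = c); last by lra.
  have Hc := apd _ c0 cpi.
  have sl := potential_slope_lt0 hs ht Hc.
  have tang (e : R) : 0 < e -> e <= pi ->
    potential s t (alpha * c) + alpha * potential_slope s t (alpha * c) * (e - c)
      <= potential s t (alpha * e).
    move=> e0 epi; have [->|ec] := eqVneq e c; first by rewrite subrr mulr0 addr0.
    have := potential_tangent hs ht Hc (apd _ e0 epi).
    rewrite (inj_eq (mulfI (lt0r_neq0 ha0))) => /(_ ec).
    by nra.
  have [dpi|dpi] := leP d pi.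
    rewrite (min_idPl _); last by lra.
    have := potential_tangent hs ht Hc (apd _ d0 dpi).
    rewrite (inj_eq (mulfI (lt0r_neq0 ha0))) => /(_ dc).
    by nra.
  rewrite (min_idPr _); last by lra.
  apply: lt_le_trans (tang _ _ _); [|lra|lra].
  by rewrite ltrD2l -!mulrA ltr_pM2l// ltr_nM2l//; lra.
exists (fun c => if c <= pi then alpha * potential_slope s t (alpha * c)
  else - (alpha * potential_slope s t (alpha * (2 * pi - c)))) => c d c2 d2 dc.
case: ifPn => [cpi|]; first by apply: near => //; lra.
rewrite -ltNge => cpi.
have dc' : 2 * pi - d != 2 * pi - c by apply: contra_neq dc => ?; lra.
have := near (2 * pi - c) (2 * pi - d) _ _ _ dc'.
rewrite /arc_potential !short_arcC (_ : _ * (_ - _) = - (alpha *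
  potential_slope s t (alpha * (2 * pi - c))) * (d - c)); last by ring.
by apply; lra.
Qed.
End Arc.

(** * Angles and geodesic distance on the circle *)

Section Geodesic.
Variables (R : realType) (alpha : R).
Hypothesis ha0 : 0 < alpha.
Implicit Types a b : R.

Lemma circle_pt_periodic a : circle_pt alpha (a + 2 * pi) = circle_pt alpha a.
Proof. by rewrite /circle_pt mulr_natl cosD2pi sinD2pi. Qed.

Lemma circle_pt_cosB a b a' b' :
  circle_pt alpha a = circle_pt alpha a' ->
  circle_pt alpha b = circle_pt alpha b' -> cos (a - b) = cos (a' - b').
Proof.
have /mulfI al_inj := lt0r_neq0 ha0.
by move=> [/al_inj ca /al_inj sa] [/al_inj cb /al_inj sb];
  rewrite !cosB ca sa cb sb.
Qed.

(** A central angle in a full turn is determined by its cosine up to passing to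
the complementary arc. *)
Lemma cos_arc_inj a b : 0 <= a <= 2 * pi -> 0 <= b <= 2 * pi ->
  cos a = cos b -> Num.min a (2 * pi - a) = Num.min b (2 * pi - b).
Proof.
move=> a2 b2 cab.
have fold (c : R) : 0 <= c <= 2 * pi ->
    Num.min c (2 * pi - c) \in `[0, pi] /\ cos (Num.min c (2 * pi - c)) = cos c.
  move=> c2; rewrite in_itv/=; case: (leP c (2 * pi - c)) => h.
    by split => //; lra.
  split; first by lra.
  by rewrite addrC mulr_natl cosD2pi cosN.
have [ai ac] := fold _ a2; have [bi bc] := fold _ b2.
by apply: cos_inj => //; rewrite ac bc.
Qed.

Lemma circle_pt_neq a b : 0 < b - a < 2 * pi ->
  circle_pt alpha a != circle_pt alpha b.
Proof.
move=> ab; apply/eqP => pab.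
have := circle_pt_cosB (erefl (circle_pt alpha b)) pab.
rewrite subrr => cba; have pi0 := pi_gt0 R.
have : Num.min 0 (2 * pi - 0) = Num.min (b - a) (2 * pi - (b - a)).
  by apply: cos_arc_inj; [lra|lra|rewrite -cba].
rewrite (min_idPl _); last by lra.
by case: leP => h; lra.
Qed.

(** The angles of two given points may be changed independently by full turns,
but the cosine of their difference is fixed.  So an arc between the points has
central angle [b - a] or [2 * pi - (b - a)], and both occur. *)
Lemma geodesic_distE a b : 0 < b - a < 2 * pi ->
  geodesic_dist alpha (circle_pt alpha a) (circle_pt alpha b)
  = short_arc alpha (b - a).
Proof.
move=> ab; rewrite /geodesic_dist; set E := arc_lengths _ _ _.
have Emin : E (short_arc alpha (b - a)).
  rewrite /short_arc; case: leP => h.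
    exists a, b; split => //; first by rewrite ler_norml; lra.
    by rewrite distrC gtr0_norm//; lra.
  exists (a + 2 * pi), b; split => //; first exact: circle_pt_periodic.
    by rewrite ler_norml; lra.
  by rewrite gtr0_norm; [congr (_ * _); ring|lra].
have Elb : lbound E (short_arc alpha (b - a)).
  move=> _ [a' [b' [pa pb ab' ->]]]; rewrite /short_arc ler_pM2l//.
  rewrite -(@cos_arc_inj `|a' - b'|); first by rewrite ge_min lexx.
  - by rewrite normr_ge0.
  - by lra.
  - by rewrite distrC cos_norm (circle_pt_cosB pb pa).
apply/le_anti/andP; split; first by apply: ge_inf => //; exists (short_arc alpha (b - a)).
by apply: lb_le_inf => //; exists (short_arc alpha (b - a)).
Qed.

Lemma circle_pt_on_circle a : circle alpha (circle_pt alpha a).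
Proof.
rewrite /circle /enorm /circle_pt /= !exprMn -mulrDr cos2Dsin2 mulr1.
by rewrite sqrtr_sqr gtr0_norm.
Qed.

Lemma circle_angle (x : R * R) : circle alpha x ->
  exists2 a, 0 <= a < 2 * pi & circle_pt alpha a = x.
Proof.
case: x => x1 x2; rewrite /circle /enorm /= => nx.
have pi0 := pi_gt0 R.
have nx2 : x1 ^+ 2 + x2 ^+ 2 = alpha ^+ 2.
  by rewrite -nx sqr_sqrtr// addr_ge0// sqr_ge0.
have c1 : -1 <= x1 / alpha <= 1.
  rewrite -ler_norml normrM normfV (gtr0_norm ha0) ler_pdivrMr// mul1r.
  rewrite -(gtr0_norm ha0) -ler_sqr ?nnegrE// !real_normK ?num_real//.
  by rewrite -nx2 lerDl sqr_ge0.
have s1 : sin (acos (x1 / alpha)) = `|x2| / alpha.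
  rewrite sin_acos// (_ : 1 - _ = (x2 / alpha) ^+ 2).
    by rewrite sqrtr_sqr normrM normfV (gtr0_norm ha0).
  by rewrite !expr_div_n -nx2; field; rewrite nx2 expf_neq0// gt_eqF.
have cK : cos (acos (x1 / alpha)) = x1 / alpha by rewrite acosK.
have [a0 api] := (acos_ge0 c1, acos_lepi c1).
have [x20|x20] := leP 0 x2.
  exists (acos (x1 / alpha)); first by lra.
  by rewrite /circle_pt cK s1 ger0_norm// !(mulrC alpha) !divfK ?gt_eqF.
exists (- acos (x1 / alpha) + 2 * pi).
  have : acos (x1 / alpha) != 0.
    apply: contraTneq x20 => ac0; move: s1; rewrite ac0 sin0 => /esym/eqP.
    by rewrite mulf_eq0 invr_eq0 (gt_eqF ha0) orbF normr_eq0 => /eqP ->; rewrite ltxx.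
  move=> /negP; rewrite eq_le => /negP; rewrite negb_and; lra.
rewrite circle_pt_periodic /circle_pt cosN sinN cK s1 ltr0_norm//.
by rewrite mulNr opprK !(mulrC alpha) !divfK ?gt_eqF.
Qed.
End Geodesic.

(** * Gaps between cyclically ordered angles *)

(** For each [k] the differences [u (i + k) - u i] sum to zero over the group. *)
Lemma sum_shift_diff_eq0 (R : pzRingType) (V : finZmodType) (F u : V -> R) :
  \sum_i \sum_(j | j != i) F (j - i) * (u j - u i) = 0.
Proof.
transitivity (\sum_i \sum_j F (j - i) * (u j - u i)).
  by apply: eq_bigr => i _; rewrite [RHS](bigD1 i)//= (subrr (u i)) mulr0 add0r.
under eq_bigr do (under eq_bigr do rewrite mulrBr; rewrite sumrB).
rewrite sumrB [X in X - _]exchange_big/=; apply/eqP; rewrite subr_eq0; apply/eqP.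
apply: eq_bigr => i _; rewrite -!mulr_suml; congr (_ * _).
rewrite (reindex_inj (subrI i))/= [RHS](reindex_inj (addIr i))/=.
by apply: eq_bigr => j _; rewrite addrK subKr.
Qed.

Section Gaps.
Variables (R : realType) (n : nat).
Implicit Types (th : 'I_n.+1 -> R) (i j k : 'I_n.+1).

(** The angles increase and stay within one turn, without being normalized to
start in a fixed interval. *)
Definition cyclic_angles th := forall i j, (i < j)%N -> 0 < th j - th i < 2 * pi.

(** The counterclockwise angle from the [i]-th to the [j]-th point; one turn is
added when the way passes the last point. *)
Definition arc_gap th i j : R := th j - th i + (j < i)%:R * (2 * pi).

Lemma arc_gap_itv th i j : cyclic_angles th -> j != i ->
  0 < arc_gap th i j < 2 * pi.
Proof.
move=> thC; rewrite /arc_gap -(inj_eq val_inj) neq_ltn => /orP[] ij.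
  by have := thC _ _ ij; rewrite ij mul1r; lra.
by have := thC _ _ ij; rewrite ltnNge ltnW// mul0r; lra.
Qed.

Definition regular_gap (k : 'I_n.+1) : R := 2 * pi * k%:R / n.+1%:R.

Definition deviation th i : R := th i - regular_gap i.

(** The turn added in [arc_gap] when [j < i] matches the [n.+1] added to [j - i]
when this difference is reduced modulo [n.+1] in ['I_n.+1]. *)
Lemma arc_gapE th i j :
  arc_gap th i j = regular_gap (j - i) + (deviation th j - deviation th i).
Proof.
have N0 : n.+1%:R != 0 :> R by rewrite pnatr_eq0.
have H : (nat_of_ord (j - i)%R)%:R = j%:R - i%:R + (j < i)%:R * n.+1%:R :> R.
  have -> : nat_of_ord (j - i)%R = if (j < i)%N then (j + n.+1 - i)%N else (j - i)%N.
    rewrite /= modnDmr; have := ltn_ord i; have := ltn_ord j; move=> jn iN; case: (ltnP j i) => ji.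
      by rewrite modn_small; lia.
    by rewrite (_ : j + (n.+1 - i) = (j - i) + n.+1)%N ?modnDr ?modn_small//; lia.
  case: (ltnP j i) => ji; last by rewrite natrB// mul0r addr0.
  by rewrite natrB ?natrD; [rewrite mul1r; ring|have := ltn_ord i; lia].
by rewrite /arc_gap /deviation /regular_gap H; field.
Qed.

Lemma regular_gap_itv k : k != 0 -> 0 < regular_gap k < 2 * pi.
Proof.
move=> k0; have kn := ltn_ord k.
have {}k0 : (0 < k)%N by rewrite lt0n; apply: contra_neq k0 => k0; exact: val_inj.
have pi0 := pi_gt0 R.
rewrite /regular_gap ltr_pdivrMr ?ltr0n// ltr_pM2l; last by lra.
by rewrite ltr_nat kn andbT divr_gt0 ?ltr0n// mulr_gt0 ?ltr0n//; lra.
Qed.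

(** The gap between points [i < j] is then that of the regular polygon. *)
Lemma cyclic_angles_of_deviation th :
  (forall i j, deviation th i = deviation th j) -> cyclic_angles th.
Proof.
move=> dev i j ij; have := arc_gapE th i j.
rewrite /arc_gap ltnNge (ltnW ij) mul0r addr0 (dev j i) subrr addr0 => ->.
by apply: regular_gap_itv; rewrite subr_eq0 -(inj_eq val_inj) gtn_eqF.
Qed.
End Gaps.

(** * Configurations as cyclically ordered angles *)

Section Angles.
Variables (R : realType) (n : nat) (alpha : R).
Hypothesis ha0 : 0 < alpha.
Implicit Types (th : 'I_n.+1 -> R) (w : {fset R * R}) (i j k : 'I_n.+1).

Definition angles_of w th := cyclic_angles th /\
  perm_eq w [seq circle_pt alpha (th i) | i <- enum 'I_n.+1].

Lemma geodesic_dist_angles th i j : cyclic_angles th -> j != i ->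
  geodesic_dist alpha (circle_pt alpha (th i)) (circle_pt alpha (th j))
  = short_arc alpha (arc_gap th i j).
Proof.
move=> thC ji; have := arc_gap_itv thC ji; rewrite /arc_gap.
case: (j < i)%N => [|]; rewrite ?mul1r ?mul0r ?addr0; last exact: geodesic_distE.
by rewrite -(circle_pt_periodic alpha (th j)) addrAC; apply: geodesic_distE.
Qed.

Lemma circle_pt_angles_eq th i j : cyclic_angles th ->
  (circle_pt alpha (th i) == circle_pt alpha (th j)) = (i == j).
Proof.
move=> thC; have [->|] := eqVneq i j; first by rewrite eqxx.
rewrite -(inj_eq val_inj) neq_ltn => /orP[] ij; last rewrite eq_sym;
  by apply/negbTE/circle_pt_neq => //; exact: thC.
Qed.

Lemma log_energy_angles s t w th : angles_of w th ->
  log_energy (geodesic_dist alpha) s t w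
  = \sum_i \sum_(j | j != i) arc_potential s t alpha (arc_gap th i j).
Proof.
move=> [thC wth]; rewrite /log_energy (perm_big _ wth)/= big_map big_enum/=.
apply: eq_bigr => i _; rewrite (perm_big _ wth)/= big_map big_enum_cond/=.
apply: eq_big => j; first by rewrite circle_pt_angles_eq// eq_sym.
by move=> ij; rewrite geodesic_dist_angles// -(circle_pt_angles_eq _ _ thC) eq_sym.
Qed.

Lemma angles_of_fset w th : cyclic_angles th ->
  (forall x, x \in w <-> exists i, x = circle_pt alpha (th i)) -> angles_of w th.
Proof.
move=> thC wth; split=> //; apply: uniq_perm; first exact: fset_uniq.
  rewrite map_inj_in_uniq ?enum_uniq// => i j _ _ /eqP.
  by rewrite circle_pt_angles_eq// => /eqP.
move=> x; apply/idP/mapP => [/wth[i ->]|[i _ ->]]; first by exists i; rewrite ?mem_enum.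
by apply/wth; exists i.
Qed.

Lemma angles_of_config w th : angles_of w th -> is_config (circle alpha) n.+1 w.
Proof.
move=> [thC wth]; split; last first.
  by rewrite (perm_size wth) size_map size_enum_ord.
move=> x; rewrite (perm_mem wth) => /mapP[i _ ->].
exact: circle_pt_on_circle.
Qed.

(** Sorting angles chosen in a single half-open turn makes them cyclically
ordered. *)
Lemma config_angles w : is_config (circle alpha) n.+1 w ->
  exists th, angles_of w th.
Proof.
move=> [wC wN].
have [ang angP] : {ang : R * R -> R & forall x, x \in w ->
    0 <= ang x < 2 * pi /\ circle_pt alpha (ang x) = x}.
  apply: (@choice _ _ (fun x a => x \in w ->
    0 <= a < 2 * pi /\ circle_pt alpha a = x)) => x.
  have [xw|xw] := boolP (x \in w); last by exists 0.
  by have [a a2 ax] := circle_angle ha0 (wC _ xw); exists a.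
pose L := sort <=%O [seq ang x | x <- w].
have sL : size L = n.+1 by rewrite size_sort size_map.
have ltL : sorted <%O L.
  rewrite sort_lt_sorted map_inj_in_uniq ?fset_uniq// => x y xw yw exy.
  by rewrite -(angP _ xw).2 -(angP _ yw).2 exy.
have memL a : a \in L -> 0 <= a < 2 * pi.
  by rewrite mem_sort => /mapP[x /angP[xa _] ->].
exists (fun i => nth 0 L i); split.
  move=> i j ij.
  have lt : nth 0 L i < nth 0 L j by rewrite lt_sorted_ltn_nth ?inE ?sL.
  have := memL _ (mem_nth 0 (_ : (i < size L)%N)); rewrite sL => /(_ (ltn_ord i)).
  have := memL _ (mem_nth 0 (_ : (j < size L)%N)); rewrite sL => /(_ (ltn_ord j)).
  by lra.
have -> : [seq circle_pt alpha (nth 0 L i) | i <- enum 'I_n.+1] = map (circle_pt alpha) L.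
  rewrite -[in RHS](mkseq_nth 0 L) sL /mkseq -val_enum_ord -!map_comp.
  exact: eq_map.
rewrite perm_sym; apply: perm_trans (perm_map _ (permEl (perm_sort _ _))) _.
by rewrite -map_comp map_id_in// => x /angP[].
Qed.

End Angles.

(** * The energy bound and its equality case *)

Section Energy.
Variables (R : realType) (n : nat) (s t alpha : R).
Hypotheses (hs : 0 <= s) (ht : 1 <= t) (ha0 : 0 < alpha) (ha1 : alpha < pi^-1).
Implicit Types (th : 'I_n.+1 -> R) (w : {fset R * R}).

Definition regular_energy : R :=
  \sum_(i < n.+1) \sum_(j < n.+1 | j != i) arc_potential s t alpha (regular_gap R (j - i)).

(** Summing the tangent line inequalities at the gaps of the regular polygon:
[excess i j] is the amount by which the pair [i], [j] is above its tangent line,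
and the tangent lines add up to the energy of the regular polygon. *)
Lemma regular_energy_leif w th : angles_of alpha w th ->
  regular_energy <= log_energy (geodesic_dist alpha) s t w ?= iff
    [forall i, forall j, deviation th i == deviation th j].
Proof.
move=> wth; have [thC _] := wth.
have [mu muP] := arc_potential_tangent hs ht ha0 ha1.
pose excess i j := arc_potential s t alpha (arc_gap th i j)
  - arc_potential s t alpha (regular_gap R (j - i))
  - mu (regular_gap R (j - i)) * (deviation th j - deviation th i).
have excess_ge0 i j : j != i -> 0 <= excess i j ?= iff (deviation th i == deviation th j).
  move=> ji; rewrite /excess arc_gapE.
  have [->|ne] := eqVneq (deviation th i) (deviation th j).
    by rewrite subrr addr0 mulr0 subrr subr0; split; rewrite ?lexx ?eqxx.
  apply/leifP; rewrite -arc_gapE.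
  have := muP (regular_gap R (j - i)) (arc_gap th i j) _ (arc_gap_itv thC ji).
  rewrite regular_gap_itv ?subr_eq0// => /(_ isT).
  rewrite [X in X != _]arc_gapE -subr_eq0 addrAC subrr add0r subr_eq0 eq_sym ne => /(_ isT).
  by rewrite arc_gapE; lra.
have E : log_energy (geodesic_dist alpha) s t w =
    regular_energy + \sum_i \sum_(j | j != i) excess i j.
  rewrite (log_energy_angles ha0 s t wth).
  under [X in _ + X]eq_bigr do rewrite !sumrB.
  have /= Z := sum_shift_diff_eq0 (fun k => mu (regular_gap R k)) (deviation th).
  by rewrite !sumrB Z subr0 addrCA subrr addr0.
rewrite E; split.
  rewrite lerDl; apply: sumr_ge0 => i _; apply: sumr_ge0 => j ji.
  exact: (excess_ge0 _ _ ji).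
rewrite -subr_eq0 opprD addrA subrr add0r oppr_eq0.
rewrite psumr_eq0; last first.
  by move=> i _; apply: sumr_ge0 => j ji; exact: (excess_ge0 _ _ ji).
apply/allP/forallP => [H i|H i _].
  apply/forallP => j; have [->//|ji] := eqVneq j i.
  have := H i (mem_index_enum i); rewrite psumr_eq0; last first.
    by move=> k ki; exact: (excess_ge0 _ _ ki).
  by move=> /allP/(_ j (mem_index_enum j)); rewrite ji/= eq_sym (excess_ge0 _ _ ji).
rewrite /= big1 // => j ji; apply/eqP.
by rewrite eq_sym (excess_ge0 _ _ ji); exact: (forallP (H i)).
Qed.

Lemma equally_spaced_angles w th : angles_of alpha w th ->
  [forall i, forall j, deviation th i == deviation th j] ->
  equally_spaced alpha n.+1 w.
Proof.
move=> [thC wth] /forallP dev.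
have N0 : n.+1%:R != 0 :> R by rewrite pnatr_eq0.
pose a (k : nat) : R := th ord0 + 2 * pi * k%:R / n.+1%:R.
have thE i : th i = a i.
  have /forallP/(_ i)/eqP := dev ord0.
  by rewrite /deviation /regular_gap /a /= mulr0 mul0r subr0 => ->; rewrite subrK.
exists a; split.
- move=> x; rewrite (perm_mem wth); split.
    by move=> /mapP[i _ ->]; exists i => //; rewrite thE.
  move=> [k kn ->]; apply/mapP; exists (Ordinal kn); first by rewrite mem_enum.
  by rewrite thE.
- by rewrite /a; field.
- by move=> k kn; rewrite /a -natr1; field.
Qed.

Lemma equally_spaced_deviation w : equally_spaced alpha n.+1 w ->
  exists2 th : 'I_n.+1 -> R, angles_of alpha w th &
    [forall i, forall j, deviation th i == deviation th j].
Proof.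
move=> [a [wa _ aS]].
have N0 : n.+1%:R != 0 :> R by rewrite pnatr_eq0.
have aE (i : 'I_n.+1) : a i = a 0%N + regular_gap R i.
  case: i => i; rewrite /regular_gap /=; elim: i => [|i ih] iN.
    by rewrite mulr0 mul0r addr0.
  have aSi : a i.+1 = a i + 2 * pi / n.+1%:R.
    have step : a i.+1 - a i = 2 * pi / n.+1%:R.
      by apply: (mulfI (lt0r_neq0 ha0)); rewrite aS ?(ltnW iN)//; ring.
    by rewrite -step addrC subrK.
  by rewrite aSi (ih (ltnW iN)) -natr1; ring.
pose th (i : 'I_n.+1) := a i.
have dev i : deviation th i = a 0%N by rewrite /deviation /th aE addrK.
exists th; last by apply/forallP => i; apply/forallP => j; rewrite !dev.
apply: (angles_of_fset ha0); first by apply: cyclic_angles_of_deviation => i j; rewrite !dev.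
move=> x; rewrite wa; split => [[k kn ->]|[i ->]]; first by exists (Ordinal kn).
by exists i.
Qed.

Lemma regular_config_exists : exists w, exists2 th : 'I_n.+1 -> R,
  angles_of alpha w th & [forall i, forall j, deviation th i == deviation th j].
Proof.
have dev (i : 'I_n.+1) : deviation (@regular_gap R n) i = 0 by exact: subrr.
exists [fset x in [seq circle_pt alpha (regular_gap R i) | i <- enum 'I_n.+1]].
exists (@regular_gap R n); last by apply/forallP => i; apply/forallP => j; rewrite !dev.
apply: (angles_of_fset ha0); first by apply: cyclic_angles_of_deviation => i j; rewrite !dev.
move=> x; rewrite inE /=; split => [/mapP[i _ ->]|[i ->]]; first by exists i.
by apply/mapP; exists i; rewrite ?mem_enum.
Qed.
End Energy.

Theorem proposition2p1 (R : realType) (N : nat) (s t alpha : R)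
  (hN : (2 <= N)%N) (hs : 0 <= s) (ht : 1 <= t)
  (ha0 : 0 < alpha) (ha1 : alpha < pi^-1) (w : {fset R * R}) :
  is_minimal_config (circle alpha) (geodesic_dist alpha) s t N w <->
  is_config (circle alpha) N w /\ equally_spaced alpha N w.
Proof.
case: N hN => // n _; split => [[wC wmin]|[wC wes]].
  split=> //; have [th wth] := config_angles ha0 wC.
  have [w0 [th0 w0th0 dev0]] := regular_config_exists n ha0.
  have [wge wiff] := regular_energy_leif hs ht ha0 ha1 wth.
  have [_ w0iff] := regular_energy_leif hs ht ha0 ha1 w0th0.
  apply: (equally_spaced_angles wth); rewrite -wiff eq_le wge/=.
  have /eqP -> := etrans w0iff dev0.
  by apply: wmin; exact: (angles_of_config ha0 w0th0).
have [th wth dev] := equally_spaced_deviation ha0 wes.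
split=> // w' w'C; have [th' w'th'] := config_angles ha0 w'C.
have [_ wiff] := regular_energy_leif hs ht ha0 ha1 wth.
have /eqP <- := etrans wiff dev.
exact: (regular_energy_leif hs ht ha0 ha1 w'th').1.
Qed.
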